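(* Let $\widetilde{\mathfrak g}$ be an affine Kac–Moody algebra over an algebraically closed field $K$ of characteristic $0$. Then every commutative $2$-cocycle $\varphi$ on $\widetilde{\mathfrak g}$ is trivial, i.e. $\varphi([\widetilde{\mathfrak g},\widetilde{\mathfrak g}],\widetilde{\mathfrak g})=0$.
   Context: A commutative $2$-cocycle on a Lie algebra $L$ over $K$ is a symmetric bilinear form $\varphi:L\times L\to K$ such that $\varphi([x,y],z)+\varphi([z,x],y)+\varphi([y,z],x)=0$ for all $x,y,z\in L$; it is called trivial if it vanishes whenever one argument lies in $[L,L]$. Affine Kac–Moody algebras are taken in the standard realization: for a simple finite-dimensional Lie algebra $\mathfrak g=\bigoplus_{j\in\mathbb Z_n}\mathfrak g_j$ with a $\mathbb Z_n$-grading (coming from a diagram automorphism of order $n$; $n=1$ in the non-twisted case), let $L(\mathfrak g,n)=\bigoplus_{i\in\mathbb Z}\mathfrak g_{i\bmod n}\otimes t^i\subseteq\mathfrak g\otimes K[t,t^{-1}]$, let $\widehat L(\mathfrak g,n)$ be its standard non-split one-dimensional central extension, and the affine Kac–Moody algebra is $\widehat L(\mathfrak g,n)\oplus Kt\frac{d}{dt}$, where $t\frac{d}{dt}$ acts as a derivation of the Laurent polynomials. *)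

(* Defs.v *)
From HB Require Import structures.
From mathcomp Require Import all_boot all_order all_algebra all_fingroup.
From mathcomp Require Import boolp classical_sets functions cardinality fsbigop.

Set Implicit Arguments.
Unset Strict Implicit.
Unset Printing Implicit Defensive.

Import Order.TTheory GRing.Theory Num.Theory.
Local Open Scope ring_scope.
Local Open Scope classical_set_scope.

Section LieGeneric.
Variables (K : fieldType) (V : lmodType K).

Definition lie_algebra_on (S : set V) (br : V -> V -> V) : Prop :=
  S 0 /\
  (forall a x y, S x -> S y -> S (a *: x + y)) /\
  (forall x y, S x -> S y -> S (br x y)) /\
  (forall a x y z, S x -> S y -> S z ->
      br (a *: x + y) z = a *: br x z + br y z) /\
  (forall x, S x -> br x x = 0) /\
  (forall x y z, S x -> S y -> S z ->
      br x (br y z) + br y (br z x) + br z (br x y) = 0).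

Definition comm_cocycle_on (S : set V) (br : V -> V -> V)
    (phi : V -> V -> K) : Prop :=
  [/\ (forall x y, S x -> S y -> phi x y = phi y x),
      (forall a x y z, S x -> S y -> S z ->
          phi (a *: x + y) z = a * phi x z + phi y z)
    & (forall x y z, S x -> S y -> S z ->
          phi (br x y) z + phi (br z x) y + phi (br y z) x = 0)].

(* The derived algebra [L, L]: the linear span of all brackets of elements
   of S (finite sums of brackets, scalars absorbed into the first entry). *)
Definition derived_on (S : set V) (br : V -> V -> V) (x : V) : Prop :=
  exists s : seq (V * V),
    (forall p, p \in s -> S p.1 /\ S p.2) /\
    x = \sum_(p <- s) br p.1 p.2.

Definition trivial_cocycle_on (S : set V) (br : V -> V -> V)
    (phi : V -> V -> K) : Prop :=
  forall x y, derived_on S br x -> S y -> phi x y = 0 /\ phi y x = 0.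

End LieGeneric.

Section FinDimLie.
Variables (K : fieldType) (g : vectType K) (br : g -> g -> g).

Definition simple_lie : Prop :=
  (exists x y, br x y != 0) /\
  forall U : {vspace g}, (forall x y, x \in U -> br y x \in U) ->
    U = 0%VS \/ U = fullv.

Definition chevalley_system (I : finType) (A : I -> I -> int)
    (e f h : I -> g) : Prop :=
  (forall i, A i i = 2%:Z) /\
  (forall i j, i != j -> A i j <= 0) /\
  (forall i j, (A i j == 0) = (A j i == 0)) /\
  free [seq h i | i <- enum I] /\
  (forall i j, br (h i) (h j) = 0) /\
  (forall i j, br (e i) (f j) = if i == j then h i else 0) /\
  (forall i j, br (h i) (e j) = (A i j)%:~R *: e j) /\
  (forall i j, br (h i) (f j) = - ((A i j)%:~R *: f j)) /\
  (forall U : {vspace g}, (forall i, e i \in U /\ f i \in U) ->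
      (forall x y, x \in U -> y \in U -> br x y \in U) -> U = fullv).

Definition lie_automorphism (s : g -> g) : Prop :=
  [/\ (forall a x y, s (a *: x + y) = a *: s x + s y),
      bijective s
    & (forall x y, s (br x y) = br (s x) (s y))].

Definition diagram_automorphism (s : g -> g) : Prop :=
  lie_automorphism s /\
  exists (I : finType) (A : I -> I -> int) (e f h : I -> g) (pi : {perm I}),
    [/\ chevalley_system A e f h,
        (forall i j, A (pi i) (pi j) = A i j)
      & (forall i, s (e i) = e (pi i) /\ s (f i) = f (pi i))].

Definition has_order (s : g -> g) (n : nat) : Prop :=
  [/\ (0 < n)%N, (forall x, iter n s x = x)
    & (forall m, (0 < m < n)%N -> ~ (forall x, iter m s x = x))].

(* Killing form  (x|y) = tr(ad x ad y), the trace being computed in the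
   basis vbasis fullv of g. *)
Definition killing (x y : g) : K :=
  \sum_(i < \dim {:g})
     coord (vbasis fullv) i (br x (br y (tnth (vbasis fullv) i))).

End FinDimLie.

(* The affine Kac--Moody algebra  L^(g, n) (+) K t d/dt.                     *)
(* Elements of g (x) K[t, t^-1] are finitely supported f : int -> g,         *)
(* f = sum_i f(i) (x) t^i.  An element of the ambient space                  *)
(* ((int -> g) * K) * K is  ((f, a), b) = f + a c + b d  with c the central  *)
(* element and d = t d/dt.                                                   *)
Notation aff_space K g := ((int -> g) * K^o * K^o)%type.

Section Affine.
Variables (K : fieldType) (g : vectType K) (br : g -> g -> g).


Definition loop_br (f h : int -> g) : int -> g :=
  fun k => \sum_(i \in [set: int]) br (f i) (h (k - i)).

Definition tder (f : int -> g) : int -> g := fun k => k%:~R *: f k.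

(* the standard cocycle  (x t^i, y t^j) |-> i delta_{i+j,0} (x|y) *)
Definition loop_cocycle (f h : int -> g) : K :=
  \sum_(i \in [set: int]) i%:~R * killing br (f i) (h (- i)).

Definition aff_br (x y : aff_space K g) : aff_space K g :=
  (loop_br x.1.1 y.1.1 + x.2 *: tder y.1.1 - y.2 *: tder x.1.1,
   loop_cocycle x.1.1 y.1.1, 0).

(* The affine Kac--Moody algebra for the Z_n-grading g_j = {x | s x = w^j x}
   (w a primitive n-th root of unity): finitely supported f with
   f(i) in g_(i mod n), plus K c + K d. *)
Definition affine_km (s : g -> g) (w : K) : set (aff_space K g) :=
  [set x | finite_set [set i | x.1.1 i != 0] /\
           forall i : int, s (x.1.1 i) = (w ^ i) *: x.1.1 i].

End Affine.

(* Main.v *)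
(* Write [X = x t^i], [Y = y t^j], [Z = z t^k], and put [psi = phi (., d)].
   The cocycle identity on [(X, Y, d)] reads
     [psi [X, Y] + (i - j) phi (X, Y) = 0],
   so off the diagonal [phi] is determined by [psi].  Substituting this in the
   identity on [(X, Y, Z)] gives, with [m = i + j + k] and up to central terms,
     [psi [[X, Y], Z] / (m - 2k) + psi [[Z, X], Y] / (m - 2j)
        + psi [[Y, Z], X] / (m - 2i) = 0].
   The numerators depend only on [m] and on the classes of [i, j, k] modulo [n]
   and sum to 0, so varying the exponents inside these classes kills all of
   them.  As [g = [[g, g], g]], [psi] vanishes, hence so does [phi (X, Y)] for
   [i <> j]; the diagonal case follows from the identity with [k = i + j].
   The central terms disappear in the same way, by invariance of the Killing
   form. *)
Require Import Defs.
From HB Require Import structures.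
From mathcomp Require Import all_boot all_order all_algebra all_fingroup.
From mathcomp Require Import boolp classical_sets functions cardinality fsbigop.
From mathcomp Require Import finmap zify ring.

Set Implicit Arguments.
Unset Strict Implicit.
Unset Printing Implicit Defensive.

Import Order.TTheory GRing.Theory Num.Theory.
Local Open Scope ring_scope.

(** Proves an equation whose two sides differ, up to ring normalisation, by exactly as much as those
    of [e]. *)
Ltac from_eq e :=
  match type of e with ?X = ?Y =>
    apply/eqP; rewrite -subr_eq0; apply/eqP; transitivity (X - Y);
    [ring | by apply/eqP; rewrite subr_eq0; apply/eqP]
  end.

(** * Elimination and additivity over a field *)

Section FieldFacts.
Variable K : fieldType.

Lemma intr_eq0_pchar0 (charK0 : [pchar K] =i pred0) (z : int) :
  (z%:~R == 0 :> K) = (z == 0).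
Proof.
have nat0 := (pcharf0P K).1 charK0.
by case: z => n; rewrite ?NegzE ?mulrNz ?oppr_eq0 /= -?pmulrn nat0.
Qed.

(** Since [P + Q != 0], the two reciprocals have different poles in [T], so together with the
    constants they are independent. Clearing denominators gives a polynomial [G] of degree at most 2
    in [T] with zeros at 0, 1, 2; its coefficients vanish one after the other, from the top, by
    finite differences. *)
Lemma three_reciprocals (P Q N r u v t c : K) :
  (2 : K) != 0 -> N != 0 -> r != 0 -> P + Q != 0 -> u + v + t = 0 ->
  (forall T : nat, [/\ P + T%:R * N != 0, Q - T%:R * N != 0 &
     u / r + v / (Q - T%:R * N) + t / (P + T%:R * N) + c = 0]) ->
  u = 0 /\ c = 0.
Proof.
move=> n2 nN nr nPQ uvt H.
pose D := c + u / r.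
pose G T : K := v * (P + T%:R * N) + t * (Q - T%:R * N)
          + D * (P + T%:R * N) * (Q - T%:R * N).
have G0 T : G T = 0.
  have [h1 h2 h3] := H T.
  rewrite -(mul0r ((P + T%:R * N) * (Q - T%:R * N))) -h3 /G /D.
  by field; rewrite nr h1 h2.
have D0 : D = 0.
  apply: (mulIf (mulf_neq0 n2 (mulf_neq0 nN nN))).
  have -> : D * (2 * (N * N)) = 2 * G 1%N - G 0%N - G 2%N by rewrite /G; ring.
  by rewrite !G0 mulr0 !subr0 mul0r.
have vt : v = t.
  apply/eqP; rewrite -subr_eq0; apply/eqP/(mulIf nN).
  have -> : (v - t) * N = G 1%N - G 0%N by rewrite /G D0; ring.
  by rewrite !G0 subr0 mul0r.
have t0 : t = 0.
  apply: (mulIf nPQ).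
  have -> : t * (P + Q) = G 0%N by rewrite /G D0 vt; ring.
  by rewrite G0 mul0r.
have u0 : u = 0 by rewrite -uvt vt t0 !addr0.
by split=> //; rewrite -D0 /D u0 mul0r addr0.
Qed.

(* The defect of additivity of [H] is symmetric in all three arguments, hence
   trilinear, but it is also odd under [x, y |-> - x, - y]. *)
Lemma additive_of_diagonal_affine (V : lmodType K) (H : V -> V -> K) :
  (2 : K) != 0 ->
  (forall x a y y', H x (a *: y + y') = a * H x y + H x y') ->
  (forall y, H 0 y = 0) ->
  (forall t x y, H (x + t *: y) y = H x y + t * H y y) ->
  forall x x' y, H (x + x') y = H x y + H x' y.
Proof.
move=> n2 Hlin H0 Hdiag.
have HD x y y' : H x (y + y') = H x y + H x y'.
  by have := Hlin x 1 y y'; rewrite scale1r mul1r.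
have Hx0 x : H x 0 = 0 by apply: (addrI (H x 0)); rewrite -HD !addr0.
have HN x y : H x (- y) = - H x y.
  by have := Hlin x (-1) y 0; rewrite scaleN1r addr0 mulN1r Hx0 addr0.
pose Q x := H x x.
(* [Hdiag] gives the polarization formula for [Q] even though left additivity of [H] is still
   unknown. *)
have QB x y : Q (y - x) = Q y + Q x - H y x - H x y.
  have e := Hdiag 1 x (y - x).
  rewrite scale1r mul1r addrC subrK -/(Q (y - x)) !HD !HN in e.
  by rewrite /Q in e *; from_eq (esym e).
have QN x : Q (- x) = Q x.
  have e := Hdiag (-1) 0 x; rewrite scaleN1r add0r H0 add0r in e.
  by rewrite /Q HN e; ring.
have Hodd x y : H (- x) y = - H x y.
  (* [O] is even in its first argument and odd in its second. It is also symmetric, because [Q] is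
     even, and therefore equals its own negative. *)
  pose O x y := H x y + H (- x) y.
  have Osym a b : O a b = O b a.
    have e : Q (b - - a) = Q (- b - a) by rewrite opprK -opprD QN.
    by rewrite !QB !QN !HN in e; rewrite /O; from_eq (esym e).
  have e : O x y = - O x y.
    rewrite [in RHS]Osym.
    have -> : O x y = O (- x) y by rewrite /O opprK addrC.
    by rewrite Osym /O !HN; ring.
  have O0 : O x y = 0.
    by apply: (mulIf n2); rewrite mul0r; from_eq e.
  by rewrite /O in O0; from_eq O0.
have QD x y : Q (y + x) = Q y + Q x + H y x + H x y.
  by have := QB (- x) y; rewrite opprK QN HN Hodd !opprK.
pose D x y z := H (x + y) z - H x z - H y z.
have DC x y z : D x y z = D y x z by rewrite /D (addrC x); ring.
have Drot x y z : D x y z = D y z x.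
  have e : Q (x + y + z) = Q (x + (y + z)) by rewrite addrA.
  by rewrite !QD !HD in e; rewrite /D; from_eq e.
have DN x y z : D x y (- z) = - D x y z by rewrite /D !HN; ring.
have DNN x y z : D (- x) (- y) z = D x y z.
  by rewrite Drot DN DC Drot Drot DN opprK 2!Drot DC.
move=> x x' y; apply/eqP; rewrite -subr_eq0 opprD addrA; apply/eqP.
rewrite -/(D x x' y); apply: (mulIf n2); rewrite mul0r.
have e : D x x' y = - D x x' y by rewrite -[LHS]DNN /D -opprD !Hodd; ring.
by from_eq e.
Qed.

End FieldFacts.

(** * Subspaces and coordinates in finite dimension *)

Section VectorSpaceFacts.
Variables (K : fieldType) (g : vectType K).

Lemma coord_vbasis_inj (x y : g) :
  (forall i, coord (vbasis fullv) i x = coord (vbasis fullv) i y) -> x = y.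
Proof.
move=> exy; rewrite (coord_vbasis (memvf x)) (coord_vbasis (memvf y)).
by apply: eq_bigr => i _; rewrite exy.
Qed.

(** A subspace of maximal dimension inside [P] absorbs every vector of [P]. This turns ideals given
    by a property into the subspaces over which simplicity quantifies. *)
Lemma vspace_of_linear_pred (P : g -> Prop) :
  P 0 -> (forall a x y, P x -> P y -> P (a *: x + y)) ->
  exists U : {vspace g}, forall x, x \in U <-> P x.
Proof.
move=> P0 Plin.
pose sub (U : {vspace g}) := forall x, x \in U -> P x.
have ex0 : exists k, `[< exists2 U, sub U & \dim U = k >].
  exists 0%N; apply/asboolP; exists 0%VS; last exact: dimv0.
  by move=> x; rewrite memv0 => /eqP ->.
have bnd k : `[< exists2 U, sub U & \dim U = k >] -> (k <= \dim {:g})%N.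
  by move=> /asboolP[U _ <-]; exact/dimvS/subvf.
have [k /asboolP[U subU dimU] kmax] := ex_maxnP ex0 bnd.
exists U => x; split; first exact: subU.
move=> Px; have subUx : sub (U + <[x]>)%VS.
  move=> _ /memv_addP[u uU [_ /vlineP[a ->] ->]].
  by rewrite addrC; apply: Plin => //; exact: subU.
have dimle : (\dim (U + <[x]>) <= \dim U)%N.
  by rewrite dimU; apply: kmax; apply/asboolP; exists (U + <[x]>)%VS.
have -> : U = (U + <[x]>)%VS by apply/eqP; rewrite eqEdim addvSl dimle.
exact/(subvP (addvSr _ _))/memv_line.
Qed.

End VectorSpaceFacts.

(** Identities linear in their vector terms are checked coordinate by coordinate, where [ring]
    applies. *)
Ltac vring := apply: coord_vbasis_inj => ?;
  rewrite ?(raddfD, raddfN, linearZ, raddf0) /=; ring.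

Ltac vfrom_eq e :=
  match type of e with ?X = ?Y =>
    apply/eqP; rewrite -subr_eq0; apply/eqP; transitivity (X - Y);
    [vring | by apply/eqP; rewrite subr_eq0; apply/eqP]
  end.

(** * Right linearity and skew-symmetry of the bracket *)

Section RightLinearity.
Variables (K : fieldType) (g : vectType K) (br : g -> g -> g).
Hypothesis (char2 : (2 : K) != 0) (char3 : (3 : K) != 0).
Hypothesis lie_g : lie_algebra_on setT br.

Lemma br_linearl a x y z : br (a *: x + y) z = a *: br x z + br y z.
Proof. by case: lie_g => _ [_ [_ [H _]]]; exact: H. Qed.

Lemma br_alt x : br x x = 0.
Proof. by case: lie_g => _ [_ [_ [_ [H _]]]]; exact: H. Qed.

Lemma jacobi x y z : br x (br y z) + br y (br z x) + br z (br x y) = 0.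
Proof. by case: lie_g => _ [_ [_ [_ [_ H]]]]; exact: H. Qed.

Lemma br_addl x y z : br (x + y) z = br x z + br y z.
Proof. by rewrite -[x]scale1r br_linearl !scale1r. Qed.

Lemma br0l z : br 0 z = 0.
Proof. by apply: (addrI (br 0 z)); rewrite -br_addl !addr0. Qed.

Lemma br_scalel a x z : br (a *: x) z = a *: br x z.
Proof. by rewrite -[a *: x]addr0 br_linearl br0l addr0. Qed.

Lemma br_oppl x z : br (- x) z = - br x z.
Proof. by rewrite -scaleN1r br_scalel scaleN1r. Qed.

(** The Jacobi identity at [x, x, x] consists of three copies of this bracket. *)
Lemma br0r x : br x 0 = 0.
Proof.
have := jacobi x x x; rewrite br_alt => e.
have : (3 : K) *: br x 0 = 0.
  by rewrite scaler_nat !mulrS addr0 addrA.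
by move/eqP; rewrite scaler_eq0 (negbTE char3) /= => /eqP.
Qed.

(** In the Jacobi identity for [x + t *: y], [y], [z] the increment leaves the last term because
    [[y, y] = 0], and left linearity expands the first. The result is the diagonal hypothesis of
    [additive_of_diagonal_affine]. *)
Lemma br_br_affine t x y z :
  br y (br z (x + t *: y)) = br y (br z x) + t *: br y (br z y).
Proof.
have e1 := jacobi (t *: y + x) y z; have e2 := jacobi x y z.
have e3 := jacobi y y z.
rewrite !br_linearl br_alt scaler0 add0r (addrC _ x) in e1.
rewrite br_alt br0r addr0 in e3.
have -> : br y (br z y) = - br y (br y z) by vfrom_eq e3.
have e := etrans e1 (esym e2).
by vfrom_eq e.
Qed.

Lemma br_br_addr y z x x' :
  br y (br z (x + x')) = br y (br z x) + br y (br z x').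
Proof.
apply: coord_vbasis_inj => i; rewrite raddfD /=.
(* The innermost entry, whose additivity is wanted, comes first; the outer entry, where linearity is
   known, comes second. *)
pose H u v : K := coord (vbasis fullv) i (br v (br z u)).
apply: (@additive_of_diagonal_affine K g H char2).
- by move=> u a v v'; rewrite /H br_linearl raddfD /= linearZ.
- by move=> v; rewrite /H !br0r raddf0.
- by move=> t u v; rewrite /H br_br_affine raddfD /= linearZ.
Qed.

Lemma br_br_skew x y z : br x (br y z) = - br x (br z y).
Proof.
have e := br_alt (y + z).
have {}e : br x (br (y + z) (y + z)) = 0 by rewrite e br0r.
rewrite br_br_addr !br_addl !br_alt add0r addr0 in e.
by vfrom_eq e.
Qed.

(** The defect [d] of homogeneity is symmetric in its first two arguments by Jacobi and changes sign
    when the outer two are exchanged. The product of these two transpositions has order 3, so its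
    cube gives [d = - d]. *)
Lemma br_br_scaler s y z x : br y (br z (s *: x)) = s *: br y (br z x).
Proof.
pose d y z x := br y (br z (s *: x)) - s *: br y (br z x).
have dC u v x' : d u v x' = d v u x'.
  have e1 := jacobi u v (s *: x'); have e2 := congr1 (fun a => s *: a) (jacobi u v x').
  rewrite /= scaler0 in e2; have e := etrans e1 (esym e2).
  rewrite [br (s *: x') (br u v)]br_scalel
    [br v (br (s *: _) _)]br_br_skew [br v (br x' _)]br_br_skew in e.
  by rewrite /d; vfrom_eq e.
have d0 u v : d u v u = 0.
  have := br_br_affine s 0 u v; rewrite br0r br0r !add0r => e.
  by rewrite /d e subrr.
have dDl u u' v x' : d (u + u') v x' = d u v x' + d u' v x'.
  by rewrite /d !br_addl; vring.
have dDr u v x' x'' : d u v (x' + x'') = d u v x' + d u v x''.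
  by rewrite /d scalerDr !br_br_addr; vring.
have dE : d y z x = br y (br z (s *: x)) - s *: br y (br z x) by [].
clearbody d.
have d13 u v x' : d u v x' = - d x' v u.
  have e := d0 (u + x') v; rewrite dDl !dDr !d0 add0r addr0 in e.
  by vfrom_eq e.
have e : d y z x = - d y z x by rewrite {1}dC d13 dC d13 dC d13 opprK.
have : (2 : K) *: d y z x = 0 by rewrite scaler_nat mulr2n {1}e addNr.
by move/eqP; rewrite scaler_eq0 (negbTE char2) dE /= subr_eq0 => /eqP.
Qed.

(* [lie_algebra_on] only asks for linearity on the left; simplicity forces
   skew-symmetry because the elements [v] with [[y, [z, v]] = 0] for all [y]
   and [z] form an ideal that contains every [[x, y] + [y, x]]. *)
Lemma br_skew (simple_g : simple_lie br) x y : br x y = - br y x.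
Proof.
case: simple_g => -[y0 [z0 b0]] ideal.
pose P v := forall y z, br y (br z v) = 0.
have [||U UP] := @vspace_of_linear_pred K g P.
- by move=> u v; rewrite !br0r.
- move=> a u v Pu Pv b c.
  by rewrite br_br_addr br_br_scaler Pu Pv scaler0 addr0.
have PS u v : P (br u v + br v u).
  move=> a b; rewrite br_br_addr [br b (br u v)]br_br_skew -br_oppl.
  rewrite [br a (br (- b) _)]br_br_skew -[- b]scaleN1r br_br_scaler scaleN1r opprK.
  by rewrite [br a (br _ b)]br_br_skew addNr.
have [|U0|UT] := ideal U.
- by move=> u v /UP Pu; apply/UP => a b; rewrite Pu br0r.
- have /UP := PS x y; rewrite U0 memv0 => /eqP e; by vfrom_eq e.
(* In the remaining case all double brackets vanish, so the nonzero line through [br y0 z0] is an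
   ideal. It cannot be all of [g]: then [z0] would lie on it and [br y0 z0] would itself be a double
   bracket. *)
have bb0 a b c : br a (br b c) = 0 by have := memvf c; rewrite -UT => /UP; apply.
have [|/eqP|LT] := ideal <[br y0 z0]>%VS.
- by move=> _ v /vlineP[a ->]; rewrite -br_scalel bb0 mem0v.
- by rewrite -subv0 -memvE memv0 (negbTE b0).
have : z0 \in <[br y0 z0]>%VS by rewrite LT memvf.
move=> /vlineP[a za]; move: b0; rewrite {1}za -br_scalel bb0 eqxx //.
Qed.

End RightLinearity.

(** * Perfectness and the Killing form *)

Section SimpleLieAlgebra.
Variables (K : fieldType) (g : vectType K) (br : g -> g -> g).
Hypothesis (char2 : (2 : K) != 0) (char3 : (3 : K) != 0).
Hypotheses (lie_g : lie_algebra_on setT br) (simple_g : simple_lie br).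

Let skew := br_skew char2 char3 lie_g simple_g.

Lemma br_linearr a x y z : br z (a *: x + y) = a *: br z x + br z y.
Proof. by rewrite skew br_linearl // opprD -scalerN -!skew. Qed.

Lemma br_addr x y z : br z (x + y) = br z x + br z y.
Proof. by rewrite -[x]scale1r br_linearr !scale1r. Qed.

Lemma br_scaler a x z : br z (a *: x) = a *: br z x.
Proof. by rewrite skew br_scalel // -scalerN -skew. Qed.

Lemma br_suml I (r : seq I) (F : I -> g) z :
  br (\sum_(i <- r) F i) z = \sum_(i <- r) br (F i) z.
Proof. by apply: (big_morph (br^~ z)) => [x y|]; rewrite ?br_addl // br0l. Qed.

Lemma br_sumr I (r : seq I) (F : I -> g) z :
  br z (\sum_(i <- r) F i) = \sum_(i <- r) br z (F i).
Proof. by apply: (big_morph (br z)) => [x y|]; rewrite ?br_addr // br0r. Qed.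

(** The span of all brackets is a nonzero ideal, hence everything; this is stated as an induction
    principle. *)
Lemma simple_lie_perfect (P : g -> Prop) :
  P 0 -> (forall x y, P x -> P y -> P (x + y)) ->
  (forall x y, P (br x y)) -> forall x, P x.
Proof.
move=> P0 PD Pbr x.
pose D z := exists s : seq (g * g), z = \sum_(p <- s) br p.1 p.2.
have [||U UD] := @vspace_of_linear_pred K g D.
- by exists [::]; rewrite big_nil.
- move=> a _ _ [s ->] [s' ->].
  exists ([seq (a *: p.1, p.2) | p <- s] ++ s').
  rewrite big_cat big_map /= scaler_sumr; congr (_ + _).
  by apply: eq_bigr => p _; rewrite br_scalel.
have [|U0|UT] := simple_g.2 U.
- by move=> u v _; apply/UD; exists [:: (v, u)]; rewrite big_seq1.
- have [y [z /negP[]]] := simple_g.1; rewrite -memv0 -U0.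
  by apply/UD; exists [:: (y, z)]; rewrite big_seq1.
have := memvf x; rewrite -UT => /UD[s ->].
by apply: big_ind => // p _; exact: Pbr.
Qed.

(** By conversion [killing br x y] is the trace of [br x \o br y], for plain functions. *)
Definition vtrace (A : g -> g) : K :=
  \sum_(i < \dim {:g}) coord (vbasis fullv) i (A (tnth (vbasis fullv) i)).

Lemma vtraceC (A B : g -> g) :
  (forall a x y, A (a *: x + y) = a *: A x + A y) ->
  (forall a x y, B (a *: x + y) = a *: B x + B y) ->
  vtrace (A \o B) = vtrace (B \o A).
Proof.
pose e i : g := tnth (vbasis fullv) i.
have exp (C E : g -> g) : (forall a x y, C (a *: x + y) = a *: C x + C y) ->
    vtrace (C \o E) = \sum_i \sum_j coord (vbasis fullv) j (E (e i))
                                   * coord (vbasis fullv) i (C (e j)).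
  move=> Clin; apply: eq_bigr => i _ /=.
  have C0 : C 0 = 0.
    by have := Clin (-1) 0 0; rewrite scaler0 addr0 scaleN1r addNr.
  have CD x y : C (x + y) = C x + C y by rewrite -[x]scale1r Clin !scale1r.
  rewrite [in LHS](coord_vbasis (memvf (E _))) (big_morph C CD C0) raddf_sum /=.
  apply: eq_bigr => j _; rewrite -(addr0 (_ *: _)) Clin C0 addr0 linearZ /=.
  by rewrite /e !(tnth_nth 0).
move=> Alin Blin; rewrite !exp // exchange_big /=.
by apply: eq_bigr => i _; apply: eq_bigr => j _; rewrite mulrC.
Qed.

Lemma vtraceB (A B : g -> g) : vtrace (fun x => A x - B x) = vtrace A - vtrace B.
Proof. by rewrite /vtrace -sumrB; apply: eq_bigr => i _; rewrite raddfB. Qed.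

Lemma eq_vtrace (A B : g -> g) : A =1 B -> vtrace A = vtrace B.
Proof. by move=> AB; apply: eq_bigr => i _; rewrite AB. Qed.

Lemma killing_sym x y : killing br x y = killing br y x.
Proof.
by apply: (@vtraceC (br x) (br y)) => a u v; rewrite br_linearr.
Qed.

(** By Jacobi, [ad] turns brackets into commutators. The two sides then share the trace of [xyz] and
    differ only in those of [yxz] and [xzy], which agree by cyclicity. *)
Lemma killing_invariant x y z : killing br (br x y) z = killing br x (br y z).
Proof.
have ad u v t : br (br u v) t = br u (br v t) - br v (br u t).
  have := jacobi lie_g u v t; rewrite [br t (br u v)]skew [br t u]skew.
  rewrite -[- br u t]scaleN1r br_scaler scaleN1r => /eqP.
  by rewrite subr_eq0 => /eqP.
rewrite -[LHS]/(vtrace (fun t => br (br x y) (br z t))).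
rewrite -[RHS]/(vtrace (fun t => br x (br (br y z) t))).
rewrite (@eq_vtrace _ (fun t => br x (br y (br z t)) - br y (br x (br z t)))); last first.
  by move=> t; rewrite ad.
rewrite [RHS](@eq_vtrace _ (fun t => br x (br y (br z t)) -
    br x (br z (br y t)))); last first.
  by move=> t; rewrite ad br_addr -scaleN1r br_scaler scaleN1r.
rewrite !vtraceB; congr (_ - _).
apply: (@vtraceC (br y) (fun t => br x (br z t))) => a u v; rewrite !br_linearr //.
Qed.

End SimpleLieAlgebra.

(** * The cyclic grading by eigenspaces *)

Section Eigenspaces.
Variables (K : fieldType) (g : vectType K) (br : g -> g -> g).
Hypothesis charK0 : [pchar K] =i pred0.
Hypotheses (lie_g : lie_algebra_on setT br) (simple_g : simple_lie br).
Variables (n : nat) (s : g -> g) (w : K).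
Hypothesis (aut_s : lie_automorphism br s).
Hypothesis (s_order : forall x, iter n s x = x).
Hypothesis (prim_w : n.-primitive_root w).

Let natr_neq0 k : (0 < k)%N -> k%:R != 0 :> K.
Proof. by rewrite ((pcharf0P K).1 charK0) lt0n. Qed.

Let char2 : (2 : K) != 0. Proof. exact: natr_neq0. Qed.
Let char3 : (3 : K) != 0. Proof. exact: natr_neq0. Qed.

Definition eigen (i : int) (x : g) : Prop := s x = w ^ i *: x.

Let s_lin a x y : s (a *: x + y) = a *: s x + s y.
Proof. by case: aut_s. Qed.

Let sD x y : s (x + y) = s x + s y.
Proof. by rewrite -[x]scale1r s_lin !scale1r. Qed.

Let s0 : s 0 = 0.
Proof. by apply: (addrI (s 0)); rewrite -sD !addr0. Qed.

Let sZ a x : s (a *: x) = a *: s x.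
Proof. by rewrite -[a *: x]addr0 s_lin s0 addr0. Qed.

Let s_sum I (r : seq I) (F : I -> g) : s (\sum_(i <- r) F i) = \sum_(i <- r) s (F i).
Proof. exact: (big_morph s sD s0). Qed.

Let n_gt0 : (0 < n)%N. Proof. exact: prim_order_gt0 prim_w. Qed.

Let w_neq0 : w != 0.
Proof.
apply: contraTneq (oner_neq0 K) => w0.
by rewrite -(prim_expr_order prim_w) w0 expr0n gtn_eqF // eqxx.
Qed.

Let w_exp_n (T : int) : w ^ (n%:Z * T) = 1.
Proof. by rewrite -exprz_exp -exprnP (prim_expr_order prim_w) exp1rz. Qed.

Lemma eigen0 i : eigen i 0.
Proof. by rewrite /eigen s0 scaler0. Qed.

Lemma eigen_linear i a x y : eigen i x -> eigen i y -> eigen i (a *: x + y).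
Proof. by rewrite /eigen s_lin => -> ->; rewrite scalerDr !scalerA mulrC. Qed.

Lemma eigen_scale i a x : eigen i x -> eigen i (a *: x).
Proof. by move=> ex; rewrite -[_ *: _]addr0; exact: eigen_linear (eigen0 i). Qed.

Lemma eigen_shift i (T : int) x : eigen i x -> eigen (i + n%:Z * T) x.
Proof. by rewrite /eigen => ->; rewrite expfzDr // w_exp_n mulr1. Qed.

Lemma eigen_br i j x y : eigen i x -> eigen j y -> eigen (i + j) (br x y).
Proof.
rewrite /eigen; have [_ _ ->] := aut_s => -> ->.
by rewrite br_scalel // (br_scaler char2 char3) // scalerA expfzDr.
Qed.

Let iterD l x y : iter l s (x + y) = iter l s x + iter l s y.
Proof. by elim: l => //= l ->; rewrite sD. Qed.

Let iter_br l x y : iter l s (br x y) = br (iter l s x) (iter l s y).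
Proof. by elim: l => //= l ->; case: aut_s => _ _ ->. Qed.

Let iter_eigen l i x : eigen i x -> iter l s x = (w ^ i) ^+ l *: x.
Proof. by move=> ex; elim: l => [|l /= ->]; rewrite ?scale1r // sZ ex scalerA exprSr. Qed.

(** The projector onto degree [m]: the average over the powers of [s], twisted by a character of the
    cyclic group. *)
Definition eigen_proj (m : int) (x : g) : g :=
  n%:R^-1 *: \sum_(l < n) (w ^ (- m)) ^+ l *: iter l s x.

Let eigen_proj0 m : eigen_proj m 0 = 0.
Proof.
rewrite /eigen_proj big1 ?scaler0 // => l _.
by rewrite (iter_eigen _ (eigen0 0)) !scaler0.
Qed.

Let eigen_projD m x y : eigen_proj m (x + y) = eigen_proj m x + eigen_proj m y.
Proof.
rewrite /eigen_proj -scalerDr -big_split; congr (_ *: _).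
by apply: eq_bigr => l _; rewrite iterD scalerDr.
Qed.

Lemma eigen_proj_id m x : eigen m x -> eigen_proj m x = x.
Proof.
move=> ex; rewrite /eigen_proj (eq_bigr (fun=> x)).
  rewrite sumr_const card_ord -scaler_nat scalerA mulVf ?scale1r //.
  exact: natr_neq0.
move=> l _; rewrite (iter_eigen _ ex) scalerA -exprMn.
by rewrite -expfzDr // addNr expr0z expr1n scale1r.
Qed.

Lemma eigen_eigen_proj m x : eigen m (eigen_proj m x).
Proof.
set v := w ^ (- m).
have vn : v ^+ n = 1 by rewrite exprnP exprz_exp mulrC w_exp_n.
rewrite /eigen /eigen_proj sZ scalerA mulrC -scalerA; congr (_ *: _).
pose F l := v ^+ l *: iter l s x.
(* Applying [s] shifts the summation index; the sum is unchanged since [F n = F 0]. *)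
have shift : \sum_(l < n) F l.+1 = \sum_(l < n) F l.
  apply: (addrI (F 0%N)); rewrite -(big_ord_recl n (fun l => F l)) big_ord_recr addrC /=.
  by congr (_ + _); rewrite /F vn s_order expr0.
rewrite s_sum -/v -[in RHS]shift scaler_sumr; apply: eq_bigr => l _.
rewrite sZ /F scalerA exprS mulrA -expfzDr // subrr mul1r //.
Qed.

(** After exchanging the sums, orthogonality of the powers of [w] leaves only the term [l = 0]. *)
Lemma sum_eigen_proj x : \sum_(j < n) eigen_proj j%:Z x = x.
Proof.
rewrite /eigen_proj -scaler_sumr exchange_big /=.
rewrite (eq_bigr (fun l : 'I_n =>
  (if l == 0%N :> nat then n%:R else 0) *: iter l s x)); last first.
  move=> l _; rewrite -scaler_suml; congr (_ *: _).
  pose z := w ^ (- l%:Z).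
  rewrite (eq_bigr (fun j : 'I_n => z ^+ j)); last first.
    by move=> j _; rewrite !exprnP !exprz_exp mulNr mulrC -mulNr.
  case: eqP => [l0|/eqP l0].
    rewrite (eq_bigr (fun=> 1)) ?sumr_const ?card_ord // => j _.
    by rewrite /z l0 oppr0 expr0z expr1n.
  have z1 : z - 1 != 0.
    rewrite subr_eq0 /z -exprz_inv -exprnP exprVn invr_eq1.
    rewrite -(prim_order_dvd prim_w) gtnNdvd // lt0n //.
  apply: (mulfI z1); rewrite mulr0 -subrX1 /z exprnP exprz_exp mulrC w_exp_n subrr //.
rewrite (bigD1 (Ordinal n_gt0)) //= big1 ?addr0.
  by rewrite scalerA mulVf ?scale1r // natr_neq0.
by move=> l; rewrite -val_eqE /= => /negbTE ->; rewrite scale0r.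
Qed.

Lemma eigen_proj_br m a x y :
  eigen a x -> eigen_proj m (br x y) = br x (eigen_proj (m - a) y).
Proof.
move=> ex; rewrite /eigen_proj (br_scaler char2 char3) //; congr (_ *: _).
rewrite (br_sumr char2 char3) //; apply: eq_bigr => l _.
rewrite iter_br (iter_eigen _ ex) br_scalel // scalerA -exprMn -expfzDr //.
by rewrite (br_scaler char2 char3) // opprB addrC.
Qed.

(** A graded form of perfectness. Write an element as a sum of brackets, split the left entries into
    homogeneous components and project to degree [m]; the projector then acts on the right entries
    only. *)
Lemma eigen_ind m (P : g -> Prop) :
  P 0 -> (forall x y, eigen m x -> eigen m y -> P x -> P y -> P (x + y)) ->
  (forall a x y, eigen a x -> eigen (m - a) y -> P (br x y)) ->
  forall x, eigen m x -> P x.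
Proof.
move=> P0 PD Pbr x /eigen_proj_id <-.
move: x; apply: (simple_lie_perfect lie_g simple_g).
- by rewrite eigen_proj0.
- by move=> x y Px Py; rewrite eigen_projD; apply: PD => //; exact: eigen_eigen_proj.
move=> x y; rewrite -(sum_eigen_proj x) br_suml //.
rewrite (big_morph _ (eigen_projD m) (eigen_proj0 m)).
pose Q z := eigen m z /\ P z.
suff [] : Q (\sum_(j < n) eigen_proj m (br (eigen_proj j%:Z x) y)) by [].
apply: (big_ind Q).
- by split=> //; exact: eigen0.
- move=> u v [eu Pu] [ev Pv]; split; last exact: PD.
  by rewrite -[u]scale1r; exact: eigen_linear.
move=> j _; split; first exact: eigen_eigen_proj.
rewrite (eigen_proj_br _ _ (eigen_eigen_proj j%:Z x)).
by apply: (Pbr j%:Z); exact: eigen_eigen_proj.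
Qed.

End Eigenspaces.

(** * The affine algebra: brackets of monomials, closure and generation *)

Section Affine.
Variables (K : fieldType) (g : vectType K) (br : g -> g -> g).
Hypothesis charK0 : [pchar K] =i pred0.
Hypotheses (lie_g : lie_algebra_on setT br) (simple_g : simple_lie br).
Variables (n : nat) (s : g -> g) (w : K).
Hypothesis (aut_s : lie_automorphism br s).
Hypothesis (s_order : forall x, iter n s x = x).
Hypothesis (prim_w : n.-primitive_root w).

Let char2 : (2 : K) != 0. Proof. by rewrite ((pcharf0P K).1 charK0). Qed.
Let char3 : (3 : K) != 0. Proof. by rewrite ((pcharf0P K).1 charK0). Qed.
Let n_gt0 : (0 < n)%N. Proof. exact: prim_order_gt0 prim_w. Qed.

Notation eig := (eigen s w).
Notation S := (affine_km s w).

(* [monomial i x] is [x t^i], [aff_c] the central element and [aff_d = t d/dt]. *)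
Definition monomial (i : int) (x : g) : int -> g := fun k => if k == i then x else 0.
Definition aff_tm (i : int) (x : g) : aff_space K g := (monomial i x, 0, 0).
Definition aff_c : aff_space K g := (0, 1, 0).
Definition aff_d : aff_space K g := (0, 0, 1).

Lemma killing0l x : killing br 0 x = 0.
Proof. by rewrite /killing big1 // => i _; rewrite br0l // raddf0. Qed.

Lemma killing0r x : killing br x 0 = 0.
Proof. by rewrite (killing_sym char2 char3) // killing0l. Qed.

Lemma loop_br0l h : loop_br br 0 h = 0.
Proof. by apply/funext => k; apply: fsbig1 => i _; rewrite br0l. Qed.

Lemma loop_br0r f : loop_br br f 0 = 0.
Proof. by apply/funext => k; apply: fsbig1 => i _; rewrite br0r. Qed.

Lemma loop_cocycle0l h : loop_cocycle br 0 h = 0.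
Proof. by apply: fsbig1 => i _; rewrite killing0l mulr0. Qed.

Lemma loop_cocycle0r f : loop_cocycle br f 0 = 0.
Proof. by apply: fsbig1 => i _; rewrite killing0r mulr0. Qed.

Lemma loop_br_monomial i j x y :
  loop_br br (monomial i x) (monomial j y) = monomial (i + j) (br x y).
Proof.
apply/funext => k; rewrite /loop_br (@fsbigTE _ _ _ _ [fset i]%fset).
  rewrite big_seq_fset1 /monomial eqxx subr_eq addrC.
  by case: ifP; rewrite ?br0r.
by move=> l; rewrite inE /monomial => /negbTE ->; rewrite br0l.
Qed.

Lemma loop_cocycle_monomial i j x y :
  loop_cocycle br (monomial i x) (monomial j y) =
  if i + j == 0 then i%:~R * killing br x y else 0.
Proof.
rewrite /loop_cocycle (@fsbigTE _ _ _ _ [fset i]%fset).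
  rewrite big_seq_fset1 /monomial eqxx eq_sym -addr_eq0 addrC.
  by case: ifP; rewrite ?killing0r ?mulr0.
by move=> l; rewrite inE /monomial => /negbTE ->; rewrite killing0l mulr0.
Qed.

Lemma monomial_linear i a x y :
  monomial i (a *: x + y) = a *: monomial i x + monomial i y.
Proof.
apply/funext => k; rewrite /monomial.
rewrite -[RHS]/(a *: (if k == i then x else 0) + (if k == i then y else 0)).
by case: ifP => // _; rewrite scaler0 addr0.
Qed.

Lemma monomial0 i : monomial i 0 = 0.
Proof. by apply/funext => k; rewrite /monomial; case: ifP. Qed.

Lemma tder0 : tder (0 : int -> g) = 0.
Proof. by apply/funext => k; rewrite /tder scaler0. Qed.

Lemma tder_monomial i x : tder (monomial i x) = monomial i (i%:~R *: x).
Proof.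
apply/funext => k; rewrite /tder /monomial.
by case: eqP => [->//|_]; rewrite scaler0.
Qed.

Lemma tm_linear i a x y : aff_tm i (a *: x + y) = a *: aff_tm i x + aff_tm i y.
Proof. by rewrite /aff_tm monomial_linear; congr (_, _, _); rewrite /= scaler0 addr0. Qed.

Lemma tm0 i : aff_tm i 0 = 0.
Proof. by rewrite /aff_tm monomial0. Qed.

Definition central_coef i j x y : K := if i + j == 0 then i%:~R * killing br x y else 0.

Lemma aff_br_tm i j x y :
  aff_br br (aff_tm i x) (aff_tm j y) =
  central_coef i j x y *: aff_c + aff_tm (i + j) (br x y).
Proof.
rewrite /aff_br /= loop_br_monomial loop_cocycle_monomial !scale0r subr0 addr0.
congr (_, _, _); rewrite /= ?scaler0 ?add0r ?addr0 //.
by rewrite -[_ *: 1]/(_ * 1) mulr1.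
Qed.

Lemma aff_br_dd_tm i x : aff_br br aff_d (aff_tm i x) = aff_tm i (i%:~R *: x).
Proof.
rewrite /aff_br /= loop_br0l loop_cocycle0l tder0 tder_monomial.
by rewrite scale1r scaler0 subr0 add0r.
Qed.

Lemma aff_br_tm_dd i x : aff_br br (aff_tm i x) aff_d = aff_tm i (- (i%:~R *: x)).
Proof.
rewrite /aff_br /= loop_br0r loop_cocycle0r tder0 tder_monomial.
rewrite scale1r scaler0 add0r sub0r.
congr (_, _, _); apply/funext => k; rewrite /monomial.
by rewrite -[LHS]/(- (if k == i then i%:~R *: x else 0)); case: ifP; rewrite ?oppr0.
Qed.

Lemma aff_br_cc_tm i x : aff_br br aff_c (aff_tm i x) = 0.
Proof. by rewrite /aff_br /= loop_br0l loop_cocycle0l tder0 !scale0r subr0 addr0. Qed.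

Lemma aff_br_tm_cc i x : aff_br br (aff_tm i x) aff_c = 0.
Proof. by rewrite /aff_br /= loop_br0r loop_cocycle0r tder0 !scale0r subr0 addr0. Qed.

Lemma affine_km_eq (x y : aff_space K g) : x.1.1 = y.1.1 -> S x -> S y.
Proof. by rewrite /affine_km /= => ->. Qed.

Lemma affine_km0 : S 0.
Proof.
split=> [|i]; last exact: (eigen0 w aut_s).
by apply: (@sub_finite_set _ _ set0%classic) => // i /=; rewrite eqxx.
Qed.

Lemma affine_km_linear a x y : S x -> S y -> S (a *: x + y).
Proof.
move=> [fx ex] [fy ey]; split=> [|i]; last first.
  exact: (eigen_linear aut_s _ (ex i) (ey i)).
apply: (@sub_finite_set _ _ ([set i | x.1.1 i != 0] `|` [set i | y.1.1 i != 0])%classic).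
  move=> i /=; case: (eqVneq (x.1.1 i) 0) => [x0|]; last by left.
  case: (eqVneq (y.1.1 i) 0) => [y0|]; last by right.
  by rewrite -[(_ + _) i]/(a *: x.1.1 i + y.1.1 i) x0 y0 scaler0 addr0 eqxx.
by rewrite finite_setU.
Qed.

Lemma affine_km_tm i x : eig i x -> S (aff_tm i x).
Proof.
move=> ex; split=> [|k] /=.
  apply: (@sub_finite_set _ _ [set i]%classic) => // k /=.
  by rewrite /monomial; case: (eqVneq k i) => //; rewrite eqxx.
by rewrite /monomial; case: eqP => [->|_] //; exact: (eigen0 w aut_s).
Qed.

Lemma affine_km_cc : S aff_c. Proof. exact: affine_km0. Qed.
Lemma affine_km_dd : S aff_d. Proof. exact: affine_km0. Qed.

Lemma affine_km_loop_br f h : S (f, 0, 0) -> S (h, 0, 0) -> S (loop_br br f h, 0, 0).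
Proof.
move=> [/= ff ef] [/= fh eh]; split=> [|k] /=.
  apply: sub_finite_set (finite_image2 (fun i j : int => i + j) ff fh).
  move=> k /= kn0.
  have [i _ bn0] := @fsbigN1 _ _ _ int int _ (fun k i => br (f i) (h (k - i))) k kn0.
  exists i.
    by apply: contra_neq bn0 => ->; rewrite br0l.
  exists (k - i); last by rewrite addrC subrK.
  by apply: contra_neq bn0 => ->; rewrite br0r.
(* Over the finite support of [f] this is an ordinary sum, to which linearity of the eigenspace
   applies. *)
have lE : loop_br br f h k =
    \sum_(i <- fset_set [set i | f i != 0]%classic) br (f i) (h (k - i)).
  apply: fsbigTE => i; rewrite in_fset_set // notin_setE /= => /negP.
  by rewrite negbK => /eqP ->; rewrite br0l.
rewrite lE; move: (fset_set _) => r.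
elim: (enum_fset r) => [|i e IHe]; first by rewrite big_nil; exact: (eigen0 w aut_s).
rewrite big_cons -[br _ _]scale1r; apply: (eigen_linear aut_s) => //.
have := eigen_br charK0 lie_g simple_g aut_s prim_w (ef i) (eh (k - i)).
by rewrite addrC subrK.
Qed.

Lemma affine_km_tder f : S (f, 0, 0) -> S (tder f, 0, 0).
Proof.
move=> [/= ff ef]; split=> [|k] /=; last exact: (eigen_scale aut_s).
by apply: sub_finite_set ff => i /=; apply: contra_neq => e; rewrite /tder e scaler0.
Qed.

Lemma affine_km_br x y : S x -> S y -> S (aff_br br x y).
Proof.
move=> Sx Sy; pose L f : aff_space K g := (f, 0, 0).
have Sf : S (L x.1.1) by exact: affine_km_eq Sx.
have Sh : S (L y.1.1) by exact: affine_km_eq Sy.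
apply: (@affine_km_eq (x.2 *: L (tder y.1.1) +
    ((- y.2) *: L (tder x.1.1) + L (loop_br br x.1.1 y.1.1)))).
  by rewrite /= scaleNr addrCA addrC (addrC (loop_br _ _ _)).
apply: affine_km_linear; first exact: affine_km_tder.
apply: affine_km_linear; first exact: affine_km_tder.
exact: affine_km_loop_br.
Qed.

(** The loop part is rebuilt one exponent at a time from its finite support, carrying membership in
    [S] along. *)
Lemma affine_km_ind (P : aff_space K g -> Prop) :
  P 0 -> (forall a x y, S x -> S y -> P x -> P y -> P (a *: x + y)) ->
  (forall i x, eig i x -> P (aff_tm i x)) -> P aff_c -> P aff_d ->
  forall x, S x -> P x.
Proof.
move=> P0 Plin Ptm Pcc Pdd [[f a] b] [/= ff ef].
pose L (r : seq int) : aff_space K g := (fun k => if k \in r then f k else 0, 0, 0).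
have SL (r : seq int) : uniq r -> S (L r) /\ P (L r).
  elim: r => [_|i r IHr /= /andP[ir /IHr[Sr Pr]]].
    have -> : L [::] = 0 by [].
    by split=> //; exact: affine_km0.
  have -> : L (i :: r) = 1 *: aff_tm i (f i) + L r.
    rewrite scale1r /L; congr (_, _, _); rewrite ?addr0 //.
    apply/funext => k; rewrite /aff_tm /monomial in_cons.
    rewrite -[RHS]/((if k == i then f i else 0) + (if k \in r then f k else 0)).
    by case: eqP => [->|_] /=; rewrite ?(negbTE ir) ?addr0 ?add0r.
  have Si := affine_km_tm (ef i).
  split; first exact: affine_km_linear.
  by apply: Plin => //; exact: Ptm.
pose r : seq int := fset_set [set i | f i != 0]%classic.
have [Sr Pr] := SL r (fset_uniq _).
have -> : (f, a, b) = a *: aff_c + (b *: aff_d + L r).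
  congr (_, _, _); rewrite /= ?scaler0 ?add0r ?addr0.
  - apply/funext => k; rewrite /r in_fset_set //.
    case: ifPn => //; rewrite notin_setE /= => /negP; rewrite negbK => /eqP //.
  - by rewrite -[_ *: _]/(_ * 1) mulr1.
  - by rewrite -[_ *: _]/(_ * 1) mulr1.
have Sd : S (b *: aff_d + L r) by apply: affine_km_linear => //; exact: affine_km_dd.
apply: (Plin a) => //; first exact: affine_km_cc.
by apply: Plin => //; exact: affine_km_dd.
Qed.

(** * Commutative cocycles on the affine algebra *)

Variable phi : aff_space K g -> aff_space K g -> K.
Hypothesis phi_cocycle : comm_cocycle_on S (aff_br br) phi.

Let phiC x y : S x -> S y -> phi x y = phi y x.
Proof. by case: phi_cocycle => H _ _; exact: H. Qed.

Let phiL a x y z : S x -> S y -> S z -> phi (a *: x + y) z = a * phi x z + phi y z.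
Proof. by case: phi_cocycle => _ H _; exact: H. Qed.

Let cocycle x y z : S x -> S y -> S z ->
  phi (aff_br br x y) z + phi (aff_br br z x) y + phi (aff_br br y z) x = 0.
Proof. by case: phi_cocycle => _ _; apply. Qed.

Let phi0 z : S z -> phi 0 z = 0.
Proof.
move=> Sz; have := phiL 1 affine_km0 affine_km0 Sz.
by rewrite scaler0 addr0 mul1r => e; apply: (addrI (phi 0 z)); rewrite addr0 -e.
Qed.

Let phi_tmZ i a x z : eig i x -> S z ->
  phi (aff_tm i (a *: x)) z = a * phi (aff_tm i x) z.
Proof.
move=> ex Sz; rewrite -[a *: x]addr0 tm_linear tm0 phiL ?phi0 ?addr0 //.
  exact: affine_km_tm.
exact: affine_km0.
Qed.

Let phi_tmD i x y z : eig i x -> eig i y -> S z ->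
  phi (aff_tm i (x + y)) z = phi (aff_tm i x) z + phi (aff_tm i y) z.
Proof.
move=> ex ey Sz; rewrite -{1}[x]scale1r tm_linear phiL ?mul1r //; exact: affine_km_tm.
Qed.

Let eig_br i j x y : eig i x -> eig j y -> eig (i + j) (br x y).
Proof. exact: (eigen_br charK0 lie_g simple_g aut_s prim_w). Qed.

Let phi_aff_br_tm i j x y z : eig i x -> eig j y -> S z ->
  phi (aff_br br (aff_tm i x) (aff_tm j y)) z =
  central_coef i j x y * phi aff_c z + phi (aff_tm (i + j) (br x y)) z.
Proof.
move=> ex ey Sz; rewrite aff_br_tm phiL //; first exact: affine_km_cc.
by apply: affine_km_tm; exact: eig_br.
Qed.

Let intr_neq0 (z : int) : z != 0 -> z%:~R != 0 :> K.
Proof. by rewrite intr_eq0_pchar0. Qed.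

Let cocycle_cc i j x y : eig i x -> eig j y ->
  central_coef i j x y * phi aff_c aff_c + phi (aff_tm (i + j) (br x y)) aff_c = 0.
Proof.
move=> ex ey; have Scc := affine_km_cc.
have Sx := affine_km_tm ex; have Sy := affine_km_tm ey.
have := cocycle Sx Sy Scc.
by rewrite phi_aff_br_tm // aff_br_cc_tm aff_br_tm_cc !phi0 // !addr0.
Qed.

(** The central term is present only for [m = 0]. There, moving the exponents by [n] and [- n] keeps
    the bracket but changes the factor [a] of the central term to [a + n], so the difference of the
    two identities isolates that term. *)
Let phi_tm_cc_br (m a : int) x y : eig a x -> eig (m - a) y ->
  phi (aff_tm m (br x y)) aff_c = 0 /\ (m = 0 -> killing br x y * phi aff_c aff_c = 0).
Proof.
move=> ex ey; have := cocycle_cc ex ey; rewrite subrKC => e1.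
case: (eqVneq m 0) => [m0|nm]; last first.
  split; last by move=> m0; rewrite m0 eqxx in nm.
  by move: e1; rewrite /central_coef subrKC (negbTE nm) mul0r add0r.
have /(_ 1) ex' := eigen_shift prim_w _ ex.
have /(_ (-1)) ey' := eigen_shift prim_w _ ey.
have e2 := cocycle_cc ex' ey'.
have em : a + n%:Z * 1 + (m - a + n%:Z * -1) = m by ring.
rewrite em in e2.
rewrite /central_coef em subrKC m0 eqxx in e1 e2.
have nn : (n%:Z)%:~R != 0 :> K by apply: intr_neq0; lia.
have kc : killing br x y * phi aff_c aff_c = 0.
  by apply: (mulfI nn); have e := etrans e2 (esym e1); from_eq e.
split=> //; rewrite m0.
by rewrite -mulrA kc mulr0 add0r in e1.
Qed.

(** This removes the central terms from the cocycle identity on three monomials. *)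
Let phi_cc_tm m x : eig m x -> phi aff_c (aff_tm m x) = 0.
Proof.
have Scc := affine_km_cc => ex.
rewrite phiC //; last exact: affine_km_tm.
pose P z := phi (aff_tm m z) aff_c = 0.
apply: (eigen_ind charK0 lie_g simple_g aut_s s_order prim_w (P := P) _ _ _ ex).
- by rewrite /P tm0 phi0.
- by move=> y z ey ez; rewrite /P phi_tmD // => -> ->; rewrite addr0.
by move=> a y z ey ez; case: (phi_tm_cc_br ey ez).
Qed.

Let cocycle_tm i j k x y z : eig i x -> eig j y -> eig k z ->
  phi (aff_tm (i + j) (br x y)) (aff_tm k z) + phi (aff_tm (k + i) (br z x)) (aff_tm j y)
  + phi (aff_tm (j + k) (br y z)) (aff_tm i x) = 0.
Proof.
move=> ex ey ez.
have Sx := affine_km_tm ex; have Sy := affine_km_tm ey; have Sz := affine_km_tm ez.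
have := cocycle Sx Sy Sz.
by rewrite !phi_aff_br_tm // !phi_cc_tm // !mulr0 !add0r.
Qed.

Let cocycle_dd i j x y : eig i x -> eig j y ->
  central_coef i j x y * phi aff_c aff_d + phi (aff_tm (i + j) (br x y)) aff_d
  + (i - j)%:~R * phi (aff_tm i x) (aff_tm j y) = 0.
Proof.
move=> ex ey; have Sdd := affine_km_dd.
have Sx := affine_km_tm ex; have Sy := affine_km_tm ey.
have := cocycle Sx Sy Sdd.
rewrite phi_aff_br_tm // aff_br_dd_tm aff_br_tm_dd -scaleNr !phi_tmZ //.
rewrite (phiC Sy Sx) => e; by from_eq e.
Qed.

(* Total degree 0 is the only one in which a bracket of brackets has a central
   component. *)
Let obstruction (m : int) x y z : K :=
  if m == 0 then killing br (br x y) z * phi aff_c aff_d else 0.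

Let phi_br_tm i j k x y z :
  eig i x -> eig j y -> eig k z -> (i + j - k)%:~R != 0 :> K ->
  phi (aff_tm (i + j) (br x y)) (aff_tm k z) =
  - (phi (aff_tm (i + j + k) (br (br x y) z)) aff_d / (i + j - k)%:~R)
  - obstruction (i + j + k) x y z / 2.
Proof.
move=> ex ey ez r0.
have e := cocycle_dd (eig_br ex ey) ez.
apply: (mulfI r0).
rewrite mulrBr mulrN [_ * (_ / _)]mulrCA divff // mulr1.
rewrite /central_coef in e; rewrite /obstruction.
move: e; case: eqP => [m0|_] e; last by from_eq e.
(* In degree 0 the denominator is twice the factor [i + j] of the central term, which leaves an
   obstruction free of exponents, divided by 2. *)
have r2 : (i + j - k)%:~R = 2 * (i + j)%:~R :> K.
  have -> : k = - (i + j) by lia.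
  by ring.
rewrite r2 in e *.
have -> : 2 * (i + j)%:~R * (killing br (br x y) z * phi aff_c aff_d / 2) =
  (i + j)%:~R * (killing br (br x y) z * phi aff_c aff_d) by field.
by from_eq e.
Qed.

(* Shifting [i] and [j] by opposite multiples of [n] changes the denominators in
   [phi_br_tm] but not the numerators. *)
Let nested_br_vanish (a b c : int) x y z : eig a x -> eig b y -> eig c z ->
  phi (aff_tm (a + b + c) (br (br x y) z)) aff_d = 0 /\
  obstruction (a + b + c) x y z = 0.
Proof.
move=> ex ey ez; set m := a + b + c.
(* Both [i0] and [k] exceed [|m|], which makes [j0] negative enough that [m - 2 * i0], [m - 2 * j0]
   and [m - 2 * k] are all nonzero. Raising [i0] and lowering [j0] further preserves this. *)
pose i0 : int := a + n%:Z * (`|a| + `|m| + 1).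
pose k : int := c + n%:Z * (`|c| + `|m| + 1).
pose j0 : int := m - k - i0.
have big (e : int) : e + n%:Z * (`|e| + `|m| + 1) >= `|m| + 1.
  have : n%:Z * (`|e| + `|m| + 1) >= `|e| + `|m| + 1 by rewrite ler_peMl //; lia.
  by lia.
have k_big : k >= `|m| + 1 := big c.
have i_big : i0 >= `|m| + 1 := big a.
set u := phi _ aff_d; set C := obstruction _ _ _ _.
pose v := phi (aff_tm m (br (br z x) y)) aff_d.
pose t := phi (aff_tm m (br (br y z) x)) aff_d.
have kS := killing_sym char2 char3 lie_g simple_g.
have kI := killing_invariant char2 char3 lie_g simple_g.
have skew := br_skew char2 char3 lie_g simple_g.
have Sdd := affine_km_dd.
have exyz : eig m (br (br x y) z) by apply: eig_br => //; exact: eig_br.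
have ezxy : eig m (br (br z x) y).
  have -> : m = c + a + b by rewrite /m; ring.
  by apply: eig_br => //; exact: eig_br.
have eyzx : eig m (br (br y z) x).
  have -> : m = b + c + a by rewrite /m; ring.
  by apply: eig_br => //; exact: eig_br.
have uvt : u + v + t = 0.
  have jac : br (br x y) z + (br (br z x) y + br (br y z) x) = 0.
    rewrite (skew (br x y)) (skew (br z x)) (skew (br y z)) -!opprD.
    by rewrite addrC [X in X + _]addrC jacobi // oppr0.
  rewrite /u /v /t -addrA -!phi_tmD ?jac ?tm0 ?phi0 //.
  by rewrite -[br _ y]scale1r; exact: (eigen_linear aut_s).
(* Invariance and symmetry of the Killing form make the obstruction cyclic in [x, y, z]. *)
have C2 : obstruction m z x y = C.
  by rewrite /C /obstruction; case: ifP => // _; rewrite kI kS.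
have C3 : obstruction m y z x = C.
  by rewrite -C2 /obstruction; case: ifP => // _; rewrite kI kS.
(* At [i = i0 + n * T] and [j = j0 - n * T] the denominators [m - 2 * i] and [m - 2 * j] move by
   [2 * n * T] in opposite directions, while [m - 2 * k] stays fixed. Here [P + Q] is [2 * k], and
   the constant gathers three equal obstructions. *)
have [] := @three_reciprocals K (j0 + k - i0)%:~R (k + i0 - j0)%:~R (- (n%:Z * 2)%:~R)
  (i0 + j0 - k)%:~R u v t (3 * C / 2) => //.
- by rewrite oppr_eq0; apply: intr_neq0; lia.
- by apply: intr_neq0; rewrite /j0; lia.
- rewrite -intrD; apply: intr_neq0; rewrite /j0; lia.
- move=> T.
  pose i := i0 + n%:Z * T%:Z; pose j := j0 - n%:Z * T%:Z.
  have nT : (0 : int) <= n%:Z * T%:Z by lia.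
  have eP : (j0 + k - i0)%:~R + T%:R * - (n%:Z * 2)%:~R = (j + k - i)%:~R :> K.
    by rewrite /i /j; ring.
  have eQ : (k + i0 - j0)%:~R - T%:R * - (n%:Z * 2)%:~R = (k + i - j)%:~R :> K.
    by rewrite /i /j; ring.
  have eR : i0 + j0 - k = i + j - k by rewrite /i /j; ring.
  rewrite eP eQ eR.
  have P0 : (j + k - i)%:~R != 0 :> K by apply: intr_neq0; rewrite /i /j /j0; lia.
  have Q0 : (k + i - j)%:~R != 0 :> K by apply: intr_neq0; rewrite /i /j /j0; lia.
  have R0 : (i + j - k)%:~R != 0 :> K by apply: intr_neq0; rewrite /i /j /j0; lia.
  split=> //.
  have ei : eig i x.
    have -> : i = a + n%:Z * (`|a| + `|m| + 1 + T%:Z) by rewrite /i /i0; ring.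
    exact: eigen_shift.
  have ek : eig k z by exact: eigen_shift.
  have ej : eig j y.
    have -> : j = b + n%:Z * - (`|a| + `|m| + 1 + T%:Z + (`|c| + `|m| + 1)).
      by rewrite /j /j0 /i0 /k /m; ring.
    exact: eigen_shift.
  have e := cocycle_tm ei ej ek.
  have m1 : i + j + k = m by rewrite /i /j /j0; ring.
  have m2 : k + i + j = m by rewrite -m1; ring.
  have m3 : j + k + i = m by rewrite -m1; ring.
  rewrite !phi_br_tm // m1 m2 m3 C2 C3 -/C -/u -/v -/t in e.
  have C32 : 3 * C / 2 = C / 2 + C / 2 + C / 2 by ring.
  by rewrite C32; from_eq (esym e).
move=> u0 C0; split=> //.
apply: (mulfI char3); apply: (mulIf (invr_neq0 char2)).
by rewrite C0 mulr0 mul0r.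
Qed.

Let phi_tm_dd m x : eig m x -> phi (aff_tm m x) aff_d = 0.
Proof.
have Sdd := affine_km_dd.
pose P z := phi (aff_tm m z) aff_d = 0.
apply: (eigen_ind charK0 lie_g simple_g aut_s s_order prim_w (P := P)).
- by rewrite /P tm0 phi0.
- by move=> y z ey ez; rewrite /P phi_tmD // => -> ->; rewrite addr0.
move=> a y z ey ez.
(* A second induction, on the left entry, reduces single brackets to double ones. *)
pose P' u := phi (aff_tm m (br u z)) aff_d = 0.
have em : a + (m - a) = m by rewrite subrKC.
apply: (eigen_ind charK0 lie_g simple_g aut_s s_order prim_w (P := P') _ _ _ ey).
- by rewrite /P' br0l // tm0 phi0.
- move=> u v eu ev; rewrite /P' br_addl // phi_tmD //.
    by move=> -> ->; rewrite addr0.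
  + by rewrite -em; exact: eig_br.
  + by rewrite -em; exact: eig_br.
move=> b u v eu ev; have [] := nested_br_vanish eu ev ez.
by rewrite subrKC em.
Qed.

(** Once [x] is a bracket, this is the obstruction in degree 0. *)
Let killing_cc_dd (a b : int) x y : eig a x -> eig b y -> a + b = 0 ->
  killing br x y * phi aff_c aff_d = 0.
Proof.
move=> ex ey ab0; pose P u := killing br u y * phi aff_c aff_d = 0.
have killingD u v : killing br (u + v) y = killing br u y + killing br v y.
  rewrite /killing -big_split; apply: eq_bigr => l _.
  by rewrite br_addl // raddfD.
apply: (eigen_ind charK0 lie_g simple_g aut_s s_order prim_w (P := P) _ _ _ ex).
- by rewrite /P killing0l mul0r.
- by move=> u v _ _; rewrite /P killingD mulrDl => -> ->; rewrite addr0.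
move=> i u v eu ev; have [_] := nested_br_vanish eu ev ey.
by rewrite /obstruction subrKC ab0 eqxx.
Qed.

Let phi_tm_tm i j x y : eig i x -> eig j y -> phi (aff_tm i x) (aff_tm j y) = 0.
Proof.
have offdiag (a b : int) u v : eig a u -> eig b v -> a != b ->
    phi (aff_tm a u) (aff_tm b v) = 0.
  move=> eu ev nab.
  have := cocycle_dd eu ev; rewrite phi_tm_dd; last exact: eig_br.
  have -> : central_coef a b u v * phi aff_c aff_d = 0.
    rewrite /central_coef; case: eqP => [ab0|]; last by rewrite mul0r.
    by rewrite -mulrA (killing_cc_dd eu ev ab0) mulr0.
  rewrite !add0r => /eqP; rewrite mulf_eq0 => /orP[|/eqP//].
  by rewrite intr_eq0_pchar0 // subr_eq0 (negbTE nab).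
move=> ex ey; case: (eqVneq i j) => [ij|]; last exact: offdiag.
rewrite -{}ij in ey *.
have Sy := affine_km_tm ey.
pose P u := phi (aff_tm i u) (aff_tm i y) = 0.
apply: (eigen_ind charK0 lie_g simple_g aut_s s_order prim_w (P := P) _ _ _ ex).
- by rewrite /P tm0 phi0.
- by move=> u v eu ev; rewrite /P phi_tmD // => -> ->; rewrite addr0.
move=> a u v eu ev; rewrite /P.
(* The exponents of [u] and [v] become [a + n * T] and [i - a - n * T]. The sum stays [i], and [T]
   is large enough that the other two terms of the identity with [y] lie off the diagonal. *)
pose T : int := `|a| + `|i| + 1.
have eu' := eigen_shift prim_w T eu; have ev' := eigen_shift prim_w (- T) ev.
have big : n%:Z * T >= T by rewrite ler_peMl // /T; lia.
have := cocycle_tm eu' ev' ey.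
have -> : a + n%:Z * T + (i - a + n%:Z * - T) = i by ring.
rewrite (offdiag _ _ _ _ (eig_br ey eu') ev'); last by rewrite /T; lia.
rewrite (offdiag _ _ _ _ (eig_br ev' ey) eu'); last by rewrite /T; lia.
by rewrite !addr0.
Qed.

Let phi_tm i u z : eig i u -> S z -> phi (aff_tm i u) z = 0.
Proof.
move=> eu; pose P v := phi (aff_tm i u) v = 0; have Su := affine_km_tm eu.
have Scc := affine_km_cc.
apply: (affine_km_ind (P := P)); rewrite /P.
- by rewrite phiC ?phi0 //; exact: affine_km0.
- move=> a v v' Sv Sv'; rewrite !(phiC Su) //; last exact: affine_km_linear.
  by rewrite phiL // => -> ->; rewrite mulr0 addr0.
- by move=> j v ev; exact: phi_tm_tm.
- by rewrite phiC // phi_cc_tm.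
- exact: phi_tm_dd.
Qed.

(** A bracket has only a loop part [F] and a central part. The central coefficient is a combination
    of Killing values in opposite degrees, each of which gives 0 when multiplied by
    [phi aff_c aff_c] or [phi aff_c aff_d]. *)
Let phi_aff_br p q y : S p -> S q -> S y -> phi (aff_br br p q) y = 0.
Proof.
move=> Sp Sq Sy; have Scc := affine_km_cc; have Sb := affine_km_br Sp Sq.
pose B := aff_br br p q; pose F : aff_space K g := (B.1.1, 0, 0).
have SF : S F by exact: affine_km_eq Sb.
have phiF : phi F y = 0.
  (* Dropping the last two coordinates makes the cases of [aff_c] and [aff_d] trivial, so the
     induction sees only monomials. *)
  pose P (z : aff_space K g) := phi (z.1.1, 0, 0) y = 0.
  rewrite -[_ = _]/(P B).
  apply: (affine_km_ind (P := P) _ _ _ _ _ Sb); rewrite /P.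
  - exact: phi0.
  - move=> a u v Su Sv Pu Pv.
    have -> : ((a *: u + v).1.1, 0, 0) =
        a *: (u.1.1, 0, 0) + (v.1.1, 0, 0) :> aff_space K g.
      by congr (_, _, _); rewrite /= scaler0 addr0.
    have Su1 : S (u.1.1, 0, 0) by exact: affine_km_eq Su.
    have Sv1 : S (v.1.1, 0, 0) by exact: affine_km_eq Sv.
    by rewrite phiL // Pu Pv mulr0 addr0.
  - by move=> i u eu; exact: phi_tm.
  - exact: phi0.
  - exact: phi0.
have coef0 X : (forall i, killing br (p.1.1 i) (q.1.1 (- i)) * X = 0) -> B.1.2 * X = 0.
  move=> kX; rewrite /= /loop_cocycle mulr_fsuml.
  by apply: fsbig1 => i _; rewrite -mulrA kX mulr0.
have eigp i : eig i (p.1.1 i) by exact: (Sp.2 i).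
have eigq i : eig (- i) (q.1.1 (- i)) by exact: (Sq.2 (- i)).
have phic : B.1.2 * phi aff_c y = 0.
  pose P z := B.1.2 * phi aff_c z = 0.
  apply: (affine_km_ind (P := P) _ _ _ _ _ Sy); rewrite /P.
  - by rewrite phiC ?phi0 ?mulr0 //; exact: affine_km0.
  - move=> a u v Su Sv Pu Pv; have Suv := affine_km_linear a Su Sv.
    rewrite (phiC Scc Suv) phiL // -(phiC Scc Su) -(phiC Scc Sv).
    by rewrite mulrDr Pv mulrCA Pu mulr0 addr0.
  - by move=> i u eu; rewrite phi_cc_tm // mulr0.
  - apply: coef0 => i; have eq := eigq i; rewrite -sub0r in eq.
    by have [_] := phi_tm_cc_br (eigp i) eq; rewrite sub0r; apply.
  - by apply: coef0 => i; apply: (killing_cc_dd (eigp i) (eigq i)); rewrite subrr.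
have -> : aff_br br p q = B.1.2 *: aff_c + F.
  rewrite /F /B /aff_br; congr (_, _, _); rewrite /= ?scaler0 ?add0r ?addr0 //.
  by rewrite -[_ *: _]/(_ * 1) mulr1.
by rewrite phiL // phic phiF addr0.
Qed.

Lemma affine_cocycle_trivial : trivial_cocycle_on S (aff_br br) phi.
Proof.
move=> x y [r [Sr ->]] Sy.
have [Ssum sum0] : S (\sum_(p <- r) aff_br br p.1 p.2) /\
    phi (\sum_(p <- r) aff_br br p.1 p.2) y = 0.
  elim: r Sr => [_|p r IHr Sr].
    by rewrite big_nil; split; [exact: affine_km0 | exact: phi0].
  have [|Ssum sum0] := IHr; first by move=> q qr; apply: Sr; rewrite in_cons qr orbT.
  have [Sp Sq] := Sr p (mem_head _ _).
  have Sb := affine_km_br Sp Sq.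
  rewrite big_cons -[aff_br _ _ _]scale1r; split; first exact: affine_km_linear.
  by rewrite phiL // sum0 phi_aff_br // mulr0 addr0.
by split=> //; rewrite phiC.
Qed.

End Affine.

Theorem theorem5p5 (K : closedFieldType) (charK0 : [pchar K] =i pred0)
    (g : vectType K) (br : g -> g -> g)
    (lie_g : lie_algebra_on setT br) (simple_g : simple_lie br)
    (n : nat) (s : g -> g)
    (diag_s : diagram_automorphism br s) (ord_s : has_order s n)
    (w : K) (prim_w : n.-primitive_root w)
    (phi : aff_space K g -> aff_space K g -> K) :
  comm_cocycle_on (affine_km s w) (aff_br br) phi ->
  trivial_cocycle_on (affine_km s w) (aff_br br) phi.
Proof.
case: diag_s ord_s => aut_s _ [_ s_order _].
exact: (affine_cocycle_trivial charK0 lie_g simple_g aut_s s_order prim_w).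
Qed.
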